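(* Let $n \geq 1$ be an integer and let $\mathcal{H}=(V,E)$ be a finite $n$-uniform hypergraph. If $\mathcal{H}$ is not $2$-colorable, then $m_2(\mathcal{H}) \geq n\cdot\binom{2n-1}{n}$.
   Context: A hypergraph $\mathcal{H}=(V,E)$ consists of a vertex set $V$ and a set $E$ of edges, each of which is a subset of $V$. It is $n$-uniform (an $n$-graph) if every edge has exactly $n$ elements. $\mathcal{H}$ is $2$-colorable if each vertex can be assigned one of two colors so that every edge contains vertices of both colors. A pair of edges $X, Y \in E$ is simple if $|X \cap Y| = 1$. $m_2(\mathcal{H})$ denotes the number of ordered simple pairs, i.e. the number of pairs $(X,Y) \in E \times E$ with $|X\cap Y| = 1$. *)

(* Defs.v *)
From mathcomp Require Import all_boot.

Set Implicit Arguments.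
Unset Strict Implicit.
Unset Printing Implicit Defensive.

(* A finite hypergraph is given by a finType V of vertices and a set
   E : {set {set V}} of edges. *)

Definition uniform (V : finType) (n : nat) (E : {set {set V}}) : Prop :=
  forall e : {set V}, e \in E -> #|e| = n.

Definition two_colorable (V : finType) (E : {set {set V}}) : Prop :=
  exists c : V -> bool, forall e : {set V}, e \in E ->
    (exists2 x, x \in e & c x = true) /\ (exists2 y, y \in e & c y = false).

(* Pairs are ordered, and X = Y is allowed: (X, X) counts when #|X| = 1. *)
Definition simple_pair (V : finType) (X Y : {set V}) : bool :=
  #|X :&: Y| == 1.

Definition m2 (V : finType) (E : {set {set V}}) : nat :=
  #|[set p in setX E E | simple_pair p.1 p.2]|.

(* Main.v *)
Require Import Defs.
From mathcomp Require Import all_boot.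
From mathcomp Require Import fingroup perm.

(** Order the vertices by a permutation and colour a vertex red iff it is the
last vertex of some edge. No edge avoids red, so if the hypergraph is not
2-colorable some edge Y is entirely red; its first vertex is then the last
vertex of an edge X, and (X, Y) is a simple pair in which X precedes Y. On the
other hand, for a given simple pair with union U, the pair (X, v) with
X :&: Y = [set v] is one of the n * 'C(2n-1, n) choices of an n-subset of U and
a point in it; by symmetry all choices occur as (initial segment of U, its last
element) for equally many permutations, and each permutation realizes at most
one of them. So a simple pair accounts for at most a fraction
1 / (n * 'C(2n-1, n)) of all permutations. *)

Set Implicit Arguments.
Unset Strict Implicit.
Unset Printing Implicit Defensive.

Section RandomOrder.

Variable V : finType.
Implicit Types (s p : {perm V}) (U X Y : {set V}) (v x y : V).

Definition pos s x : nat := enum_rank (s x).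

Lemma pos_inj s : injective (pos s).
Proof. by move=> x y /val_inj /enum_rank_inj /perm_inj. Qed.

(** For [v \in X] and [X \subset U] this makes [X] an initial segment of [U] with last element [v];
    weak inequalities suffice because [pos s] is injective. *)
Definition splits_at s U X v : bool :=
  [forall x in X, pos s x <= pos s v] &&
  [forall y in U :\: X, pos s v <= pos s y].

(** An ordering of all of [V] in which [v], [X] and [U] are the prefixes of lengths 1, [#|X|] and
    [#|U|], so that each can be recognized from indices alone. *)
Definition split_enum U X v : seq V :=
  (v :: enum (X :\ v)) ++ enum (U :\: X) ++ enum (~: U).

Section SplitEnum.

Variables (U X : {set V}) (v : V).
Hypotheses (sXU : X \subset U) (vX : v \in X).

Lemma mem_split_enum x : x \in split_enum U X v.
Proof.
rewrite !mem_cat in_cons !mem_enum !inE.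
by case: (x == v) => //; case: (x \in X); case: (x \in U).
Qed.

Lemma split_enum_uniq : uniq (split_enum U X v).
Proof.
rewrite !cat_uniq /= mem_enum !inE eqxx /= !enum_uniq /= andbT.
apply/andP; split; apply/hasPn => x.
- rewrite mem_cat in_cons !mem_enum !inE => /orP[/andP[xX _]|xU].
    by rewrite (negbTE xX) andbF orbF; apply: contraNneq xX => ->.
  have xX: x \notin X by apply: contra xU; apply: (subsetP sXU).
  by rewrite (negbTE xX) andbF orbF; apply: contraNneq xX => ->.
- by rewrite !mem_enum !inE => /negbTE ->; rewrite andbF.
Qed.

Lemma size_split_enum : size (split_enum U X v) = #|V|.
Proof.
rewrite -(card_uniqP split_enum_uniq).
by apply: eq_card => x; rewrite mem_split_enum.
Qed.

Lemma index_split_enum_pivot : index v (split_enum U X v) = 0.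
Proof. by rewrite /= eqxx. Qed.

Lemma index_split_enum_sub x : (index x (split_enum U X v) < #|X|) = (x \in X).
Proof.
rewrite -in_take ?mem_split_enum //.
have szX : size (v :: enum (X :\ v)) = #|X|.
  by rewrite /= -cardE (cardsD1 v X) vX.
rewrite -szX take_size_cat // in_cons mem_enum !inE.
by case: eqP => // ->.
Qed.

Lemma index_split_enum_sup x : (index x (split_enum U X v) < #|U|) = (x \in U).
Proof.
rewrite -in_take ?mem_split_enum //.
have szU : size ((v :: enum (X :\ v)) ++ enum (U :\: X)) = #|U|.
  rewrite size_cat /= -!cardE -(cardsID X U) (setIidPr sXU).
  by rewrite (cardsD1 v X) vX.
rewrite /split_enum catA -szU take_size_cat // mem_cat in_cons !mem_enum !inE.
case: eqP => [->|_] /=; first by rewrite (subsetP sXU).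
by case: (boolP (x \in X)) => // /(subsetP sXU) ->.
Qed.

End SplitEnum.

(** Match the two enumerations entry by entry: corresponding prefixes have equal lengths, hence are
    mapped onto each other. *)
Lemma perm_transport U X X' v v' :
    X \subset U -> X' \subset U -> #|X| = #|X'| -> v \in X -> v' \in X' ->
  exists p, [/\ p v = v', forall x, (p x \in X') = (x \in X)
                        & forall x, (p x \in U) = (x \in U)].
Proof.
move=> sXU sX'U cXX' vX v'X'.
pose e := split_enum U X v; pose e' := split_enum U X' v'.
(* The default [v] is never returned, since both lists have size [#|V|]. *)
pose f x := nth v e' (index x e).
have ltn_index x : index x e < size e'.
  by rewrite size_split_enum // -(size_split_enum sXU vX) index_mem mem_split_enum.
have index_f x : index (f x) e' = index x e.
  by rewrite index_uniq // split_enum_uniq.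
have f_inj : injective f.
  move=> x y fxy.
  have eq_index : index x e = index y e by rewrite -!index_f fxy.
  by rewrite -[x](nth_index v (mem_split_enum U X v x)) -/e eq_index
             nth_index // mem_split_enum.
exists (perm f_inj); split=> [|x|x]; rewrite permE.
- by rewrite /f index_split_enum_pivot.
- by rewrite -(index_split_enum_sub U v'X') index_f -cXX' index_split_enum_sub.
- by rewrite -(index_split_enum_sup sX'U v'X') index_f index_split_enum_sup.
Qed.

Lemma splits_at_mulg p s U X X' v v' :
    p v = v' -> (forall x, (p x \in X') = (x \in X)) ->
    (forall x, (p x \in U) = (x \in U)) ->
  splits_at (p * s)%g U X v -> splits_at s U X' v'.
Proof.
move=> pv pX pU /andP[/forall_inP leX /forall_inP leU].
have posM x : pos (p * s)%g x = pos s (p x) by rewrite /pos permM.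
apply/andP; split; apply/forall_inP => x.
- by rewrite -(permKV p x) pX => /leX; rewrite !posM pv.
- rewrite -(permKV p x) inE pX pU => xUX.
  by rewrite -pv -!posM leU // inE.
Qed.

(** Left multiplication by the inverse of the transporting permutation injects the first set into
    the second. *)
Lemma leq_card_splits_at U X X' v v' :
    X \subset U -> X' \subset U -> #|X| = #|X'| -> v \in X -> v' \in X' ->
  #|[set s | splits_at s U X v]| <= #|[set s | splits_at s U X' v']|.
Proof.
move=> sXU sX'U cXX' vX v'X'.
have [p [pv pX pU]] := perm_transport sXU sX'U cXX' vX v'X'.
rewrite -(card_imset [set s | splits_at s U X v] (@mulgI _ p^-1%g)).
apply: subset_leq_card.
apply/subsetP => _ /imsetP[s s_split ->]; rewrite !inE in s_split *.
by apply: (splits_at_mulg pv pX pU); rewrite mulVKg.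
Qed.

(** Otherwise, the sizes being equal, each set has a point outside the other, and each of these two
    points would have to precede the other. *)
Lemma splits_at_sub s U X X' v v' :
    X \subset U -> #|X| = #|X'| -> v \in X -> v' \in X' ->
    splits_at s U X v -> splits_at s U X' v' -> X' \subset U ->
  X \subset X'.
Proof.
move=> sXU cXX' vX v'X' /andP[/forall_inP leX /forall_inP geX].
move=> /andP[/forall_inP leX' /forall_inP geX'] sX'U.
apply/negPn/negP => nsXX'.
have /subsetPn[y yX' yX] : ~~ (X' \subset X).
  apply: contra nsXX' => sX'X.
  by have /eqP <- : X' == X by rewrite eqEcard sX'X cXX' leqnn.
have /subsetPn[x xX xX'] := nsXX'.
have le_xy : pos s x <= pos s y.
  by apply: leq_trans (leX x xX) (geX y _); rewrite inE yX (subsetP sX'U).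
have le_yx : pos s y <= pos s x.
  by apply: leq_trans (leX' y yX') (geX' x _); rewrite inE xX' (subsetP sXU).
have /pos_inj xy : pos s x = pos s y by apply/eqP; rewrite eqn_leq le_xy.
by rewrite xy yX' in xX'.
Qed.

Lemma splits_at_unique s U X X' v v' :
    X \subset U -> X' \subset U -> #|X| = #|X'| -> v \in X -> v' \in X' ->
    splits_at s U X v -> splits_at s U X' v' ->
  (X, v) = (X', v').
Proof.
move=> sXU sX'U cXX' vX v'X' sp sp'.
have eXX' : X = X'.
  apply/eqP; rewrite eqEsubset (splits_at_sub _ _ vX v'X' sp sp') //.
  by rewrite (splits_at_sub _ _ v'X' vX sp' sp).
move: sp sp' => /andP[/forall_inP leX _] /andP[/forall_inP leX' _].
have /pos_inj -> : pos s v = pos s v'.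
  by apply/eqP; rewrite eqn_leq leX' ?leX // ?eXX' // -eXX'.
by rewrite eXX'.
Qed.

Definition pointed_subsets U k : {set {set V} * V} :=
  [set q : {set V} * V | [&& q.1 \subset U, #|q.1| == k & q.2 \in q.1]].

Lemma card_pointed_subsets U k : #|pointed_subsets U k| = k * 'C(#|U|, k).
Proof.
rewrite -sum1_card.
rewrite (eq_bigl (fun q : {set V} * V =>
  ((q.1 \subset U) && (#|q.1| == k)) && (q.2 \in q.1))); last first.
  by move=> q; rewrite inE andbA.
rewrite -(pair_big_dep (fun X : {set V} => (X \subset U) && (#|X| == k))
  (fun X x => x \in X) (fun _ _ => 1)) /=.
rewrite (eq_bigr (fun _ => k)) => [|X /andP[_ /eqP <-]]; last by rewrite sum1_card.
by rewrite sum_nat_const -cards_draws cardsE mulnC.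
Qed.

(** Every pointed subset of the same size is split off by at least as many permutations as [(X, v)],
    and these families of permutations are disjoint. *)
Lemma card_splits_at U X v : X \subset U -> v \in X ->
  #|[set s | splits_at s U X v]| * (#|X| * 'C(#|U|, #|X|)) <= #|{perm V}|.
Proof.
move=> sXU vX; rewrite -card_pointed_subsets mulnC -sum_nat_const.
set T := pointed_subsets U #|X|.
apply: (@leq_trans (\sum_(q in T) #|[set s | splits_at s U q.1 q.2]|)).
  apply: leq_sum => -[X' v']; rewrite inE /= => /and3P[sX'U /eqP cX' v'X'].
  exact: leq_card_splits_at.
(* Count by permutations instead: each [s] splits [U] at one pointed subset at most. *)
under eq_bigr do rewrite -sum1dep_card big_mkcond.
rewrite exchange_big /= -sum1_card; apply: leq_sum => s _.
rewrite -big_mkcondr sum1dep_card.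
apply/card_le1_eqP => -[X1 v1] [X2 v2]; rewrite !inE /=.
move=> /andP[/and3P[sX1U /eqP cX1 v1X1] sp1] /andP[/and3P[sX2U /eqP cX2 v2X2] sp2].
by apply: (splits_at_unique _ _ _ _ _ sp2 sp1) => //; rewrite cX2.
Qed.

Definition meets_in_order s X Y : bool :=
  [exists v in X :&: Y,
    [forall x in X, pos s x <= pos s v] && [forall y in Y, pos s v <= pos s y]].

(** Take [U] to be [X :|: Y], of size [2 * n - 1]: what lies in [U] outside [X] belongs to [Y], so
    meeting in order at [v] splits [U] at [X] and [v]. *)
Lemma card_meets_in_order n X Y : #|X| = n -> #|Y| = n -> simple_pair X Y ->
  #|[set s | meets_in_order s X Y]| * (n * 'C(2 * n - 1, n)) <= #|{perm V}|.
Proof.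
move=> cX cY /cards1P[v XYv].
have vX : v \in X by have := set11 v; rewrite -XYv inE => /andP[].
have cU : #|X :|: Y| = 2 * n - 1 by rewrite cardsU cX cY XYv cards1 mul2n addnn.
apply: leq_trans (card_splits_at (subsetUl X Y) vX).
rewrite cX cU leq_mul2r; apply/orP; right.
apply: subset_leq_card; apply/subsetP => s; rewrite !inE => /exists_inP[w].
rewrite XYv => /set1P -> /andP[leX /forall_inP leY].
rewrite /splits_at leX /=; apply/forall_inP => y; rewrite !inE.
by move=> /andP[/negbTE -> /=]; apply: leY.
Qed.

Lemma exists_meets_in_order (E : {set {set V}}) s :
    set0 \notin E -> ~ two_colorable E ->
  exists X Y, [/\ X \in E, Y \in E, simple_pair X Y & meets_in_order s X Y].
Proof.
move=> E0 not_col.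
pose last_of X v := (v \in X) && [forall x in X, pos s x <= pos s v].
pose red v := [exists X in E, last_of X v].
have ne X : X \in E -> exists x, x \in X.
  by move=> XE; apply/set0Pn; apply: contraNneq E0 => <-.
have [/exists_inP[Y YE /forall_inP Yred]|no_red] :=
    boolP [exists Y in E, [forall y in Y, red y]]; last first.
  case: not_col; exists red => e eE; split.
    have [x0 x0e] := ne e eE.
    have [x /= xe xmax] := @arg_maxnP _ x0 [in e] (pos s) x0e.
    exists x => //; apply/exists_inP; exists e => //.
    by rewrite /last_of xe; apply/forall_inP.
  have /forall_inPn[y ye /negbTE blue_y] : ~~ [forall y in e, red y].
    by apply: contra no_red => red_e; apply/exists_inP; exists e.
  by exists y.
have [y0 y0Y] := ne Y YE.
have [v vY vmin] := arg_minnP (pos s) y0Y.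
have /exists_inP[X XE /andP[vX vmax]] := Yred v vY.
exists X, Y; split=> //.
(* A common vertex comes no later than [v], as it is in [X], and no earlier, as it is in [Y]. *)
- apply/cards1P; exists v; apply/setP => x; rewrite !inE.
  apply/andP/eqP => [[xX xY]|-> //].
  apply: (@pos_inj s); apply/eqP; rewrite eqn_leq vmin // andbT.
  by have /forall_inP := vmax; apply.
- apply/exists_inP; exists v; first by rewrite inE vX.
  by rewrite vmax; apply/forall_inP.
Qed.

End RandomOrder.

Theorem proposition1p1 (V : finType) (n : nat) (E : {set {set V}})
  (hn : 1 <= n) (hE : uniform n E) (hcol : ~ two_colorable E) :
  n * 'C(2 * n - 1, n) <= m2 E.
Proof.
have E0 : set0 \notin E.
  by apply/negP => /hE; rewrite cards0 => n0; rewrite -n0 in hn.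
have perm_gt0 : 0 < #|{perm V}| by apply/card_gt0P; exists 1%g.
rewrite -(leq_pmul2l perm_gt0) /m2.
set P := [set p in setX E E | _].
pose A (p : {set V} * {set V}) := #|[set s | meets_in_order s p.1 p.2]|.
(* The sum counts incidences between permutations and simple pairs met in order. Every permutation
   has at least one, which bounds it below; the bound for each single pair gives the other half. *)
apply: (@leq_trans ((\sum_(p in P) A p) * (n * 'C(2 * n - 1, n)))).
  rewrite leq_mul2r; apply/orP; right.
  rewrite /A; under eq_bigr do rewrite -sum1dep_card big_mkcond.
  rewrite exchange_big /= -sum1_card; apply: leq_sum => s _.
  have [X [Y [XE YE XYs XYo]]] := exists_meets_in_order s E0 hcol.
  by rewrite (bigD1 (X, Y)) /= ?XYo // !inE /= XE YE.
rewrite big_distrl /= [leqRHS]mulnC -sum_nat_const; apply: leq_sum => -[X Y].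
rewrite !inE /= => /andP[/andP[XE YE] XYs].
by apply: card_meets_in_order => //; apply: hE.
Qed.
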